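(* Let $d=2$ and consider the i.i.d. environment $\mathcal{G}$ with $\mu(\{e_1,e_2\})=p$ and $\mu(\{-e_1,-e_2\})=1-p$. If $p^3+2p-1\ge 0$ and $(1-p)^3+2(1-p)-1\ge 0$, then $\mathcal{G}$ has a gigantic $\mathcal{M}$-component almost surely. In consequence, the critical probability $p_c^{T}$ of oriented site percolation on the triangular lattice satisfies $p_c^{T}\ge 0.5466$.
   Context: Let $e_1,e_2$ be the standard basis of $\mathbb{Z}^2$, $\mathcal{E}=\{\pm e_1,\pm e_2\}$, and $o$ the origin. Given a probability measure $\mu$ on the power set of $\mathcal{E}$ (with $\mu(A)$ short for $\mu(\{A\})$), the environment $\mathcal{G}=(\mathcal{G}_x)_{x\in\mathbb{Z}^2}$ is a family of i.i.d. random subsets of $\mathcal{E}$ with law $\mu$. Write $x\to y$ if there are $n\ge 0$ and $x=x_0,\dots,x_n=y$ with $x_{i+1}-x_i\in\mathcal{G}_{x_i}$ for $0\le i<n$. Let $\mathcal{M}_x=\{y: x\to y\text{ and }y\to x\}$. The environment $\mathcal{G}$ has a gigantic $\mathcal{M}$-component if there is an $x$ such that $\mathcal{M}_x$ is infinite and all connected components (with respect to nearest-neighbour adjacency in $\mathbb{Z}^2$) of $\mathbb{Z}^2\setminus\mathcal{M}_x$ are finite. Oriented triangular site percolation with parameter $q$: each vertex of $\mathbb{Z}^2$ is independently open with probability $q$ and closed otherwise; an open vertex $x$ has directed edges to exactly $x-e_1$, $x+e_2$, $x-e_1+e_2$; closed vertices have no outgoing edges. The model is monotone in $q$; $p_c^{T}$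 is the critical value such that the set of vertices reachable from $o$ by directed paths is a.s. finite if $q<p_c^{T}$ and infinite with positive probability if $q>p_c^{T}$. *)

(* Defs.v *)
From HB Require Import structures.
From mathcomp Require Import all_boot all_order all_algebra.
From mathcomp Require Import all_classical all_reals all_analysis.

Set Implicit Arguments.
Unset Strict Implicit.
Unset Printing Implicit Defensive.

Import Order.TTheory GRing.Theory Num.Theory.

Local Open Scope classical_set_scope.
Local Open Scope ring_scope.

Notation Z2 := (int * int)%type.

Definition e1 : Z2 := (1, 0).
Definition e2 : Z2 := (0, 1).

Definition steps : seq Z2 := [:: e1; - e1; e2; - e2].

(* The finite type with elements e1, -e1, e2, -e2 (coerced to Z2 by [val]). *)
Definition step : finType := seq_sub steps.

(* The power set of the set of steps, with the discrete sigma-algebra. *)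
Definition local_env : Type := {set step}.
HB.instance Definition _ := Finite.copy local_env {set step}.
HB.instance Definition _ := isPointed.Build local_env (@finset.set0 step).
HB.instance Definition _ := @isMeasurable.Build default_measure_display
  local_env discrete_measurable discrete_measurable0
  discrete_measurableC discrete_measurableU.

Definition steps_in (s : seq Z2) : local_env :=
  finset (fun a : step => val a \in s).

Definition independent_RVs d d' (T : measurableType d) (T' : measurableType d')
    (R : realType) (P : probability T R) (I : eqType)
    (X : I -> {RV P >-> T'}) : Prop :=
  forall (s : seq I) (B : I -> set T'), uniq s ->
    (forall i, measurable (B i)) ->
    P (\bigcap_(i in [set` s]) (X i @^-1` B i)) =
      (\prod_(i <- s) P (X i @^-1` B i))%E.

Definition iid d d' (T : measurableType d) (T' : measurableType d')
    (R : realType) (P : probability T R) (I : eqType)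
    (X : I -> {RV P >-> T'}) (nu : probability T' R) : Prop :=
  independent_RVs X /\
  forall i (B : set T'), measurable B -> distribution P (X i) B = nu B.

Definition reachable (e : rel Z2) (x y : Z2) : Prop :=
  exists s : seq Z2, path e x s /\ last x s = y.

Definition env_edge (g : Z2 -> local_env) : rel Z2 :=
  fun x y => [exists a : step, (a \in (g x : {set step})) && (y - x == val a)].

Definition mutual_component (g : Z2 -> local_env) (x : Z2) : set Z2 :=
  [set y | reachable (env_edge g) x y /\ reachable (env_edge g) y x].

Definition adjacent : rel Z2 := fun x y => y - x \in steps.

Definition lattice_component (A : set Z2) (x : Z2) : set Z2 :=
  [set y | exists s : seq Z2, [/\ path adjacent x s, last x s = y
     & forall z, z \in x :: s -> A z]].

Definition has_gigantic_component (g : Z2 -> local_env) : Prop :=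
  exists x, infinite_set (mutual_component g x) /\
    forall y, (~` mutual_component g x) y ->
      finite_set (lattice_component (~` mutual_component g x) y).

Definition triangular_edge (op : Z2 -> bool) : rel Z2 :=
  fun x y => op x && (y \in [:: x - e1; x + e2; x - e1 + e2]).

Definition triangular_cluster (op : Z2 -> bool) : set Z2 :=
  [set y | reachable (triangular_edge op) 0 y].

(* The models for different parameters q need not be coupled: each has its own
   probability space (T q, P q). *)
Definition triangular_percolation (R : realType) (d : R -> measure_display)
    (T : forall q, measurableType (d q))
    (P : forall q, probability (T q) R)
    (op : forall q, Z2 -> {RV (P q) >-> bool}) : Prop :=
  forall q, 0 <= q <= 1 -> iid (op q) (bernoulli_prob q).

Definition critical_value (R : realType) (d : R -> measure_display)
    (T : forall q, measurableType (d q))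
    (P : forall q, probability (T q) R)
    (op : forall q, Z2 -> {RV (P q) >-> bool}) (pc : R) : Prop :=
  [/\ 0 <= pc <= 1,
      forall q, 0 <= q <= 1 -> q < pc ->
        {ae P q, forall t, finite_set (triangular_cluster (op q ^~ t))} &
      forall q, 0 <= q <= 1 -> pc < q ->
        (0 < P q [set t | infinite_set (triangular_cluster (op q ^~ t))])%E].

(* Main.v *)
(* At a site of type NE one may step up (or right), at a site of type SW left (or
   down).  From any point explore the environment towards the north-west, column
   by column: climb while the sites are NE; if the entry site of a column is SW,
   descend to exploit up to two further consecutive SW sites below it; then step
   left.  Every step reads a fresh site, so the heights [h a] at which the columns
   are entered form a random walk.  With [r] the density of SW sites, the condition
   [r ^ 3 + 2 r >= 1] says that looking down by one site already gives
   [E (h a) <= a]; looking down by two makes the inequality strict, hence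
   exponential bounds and, by Borel-Cantelli, [c a < h a < (1 - c) a] simultaneously
   for all starting points [u] and all [a] large compared with [u].  Reflections
   give the same in the other three directions, with the roles of the two
   densities exchanged for the two walks gaining in [x + y].

   - The exploration dominates the triangular cluster: the columns of the cluster
     are entered at height at most [h a < a], and symmetrically for the rows, so
     that the cluster is finite.
   - Choosing one of the four walks for [a] equal to the sup norm of the starting
     point decreases the l1 norm, so a fixed finite box is reached from everywhere;
     a site [x] of the box minimal for reachability satisfies [M_x = C_x], the set
     of sites reachable from [x].
   - A site outside [C_x] lies below a cap formed by a north-west and a south-east
     walk contained in [C_x], and above a similar cup; the region between a cap and
     a cup is finite and a nearest-neighbour path avoiding [C_x] cannot leave it. *)

Require Import Defs.
From mathcomp Require Import all_boot all_order all_algebra.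
From mathcomp Require Import all_classical all_reals all_analysis.
From mathcomp Require Import zify ring lra.
Import Order.TTheory GRing.Theory Num.Theory.
Local Open Scope classical_set_scope.
Local Open Scope ring_scope.

Set Implicit Arguments.
Unset Strict Implicit.
Unset Printing Implicit Defensive.

(** * Exploration of a column *)

Inductive phase := Enter | Climb | Descend | Deeper.

Record state := State { state_phase : phase; state_col : nat; state_ht : int }.

Definition site (s : state) : Z2 := ((state_col s)%:Z, state_ht s).

(* The walker goes up when it reads [true]; [Descend] and [Deeper] read the first
   and the second site below a blocked entry site. *)
Definition next_state (s : state) (v : bool) : state :=
  let: State p a b := s in
  match p, v with
  | Enter, true | Climb, true => State Climb a (b + 1)
  | Enter, false => State Descend a (b - 1)
  | Climb, false => State Enter a.+1 b
  | Descend, false => State Deeper a (b - 1)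
  | Descend, true | Deeper, true => State Enter a.+1 (b + 1)
  | Deeper, false => State Enter a.+1 b
  end.

Definition advance (f : Z2 -> bool) (s : state) : state := next_state s (f (site s)).

Definition explore (f : Z2 -> bool) (n : nat) : state :=
  iter n (advance f) (State Enter 0 0).

(** The sites that an exploration in state [s] may still read, the current one included. A climb has
    used up the sites below it and a descent those above it. *)
Definition future (s : state) : pred Z2 := fun i =>
  ((state_col s)%:Z < i.1) || ((i.1 == (state_col s)%:Z) &&
    match state_phase s with
    | Enter => true
    | Climb => state_ht s <= i.2
    | Descend | Deeper => i.2 <= state_ht s
    end).

Lemma future_site s : future s (site s).
Proof. by case: s => -[] a b; rewrite /future /site /= eqxx ?lexx ?orbT. Qed.

(** This is the freshness of the sites read: whatever the answer [v], the site just read leaves the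
    future for good. *)
Lemma future_next s v i : future (next_state s v) i -> future s i /\ i != site s.
Proof.
case: s i v => -[] a b [x y] [] /=; rewrite /future /site xpair_eqE /=; lia.
Qed.

(* One column of the exploration, entered at height [h] and left at height [h']. *)
Definition column_step (f : Z2 -> bool) (a : nat) (h h' : int) : Prop :=
  (forall b, h <= b < h' -> f (a%:Z, b)) /\
  (forall b, h' <= b <= Num.max h h' -> ~~ f (a%:Z, b)).

Definition entry_heights (f : Z2 -> bool) (h : nat -> int) : Prop :=
  h 0%N = 0 /\ forall a, column_step f a (h a) (h a.+1).

Lemma explore_climb f n a b k :
  explore f n = State Enter a b -> (0 < k)%N ->
  (forall j, (j < k)%N -> f (a%:Z, b + j%:Z)) ->
  explore f (n + k)%N = State Climb a (b + k%:Z).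
Proof.
move=> En; case: k => // k _; elim: k => [|k IH] Hf.
  rewrite addn1 /explore iterS -/(explore f n) En /advance /site /=.
  by have := Hf 0%N isT; rewrite addr0 => ->.
rewrite addnS /explore iterS -/(explore _ _) IH /advance /site /=; last first.
  by move=> j jk; apply: Hf; lia.
by rewrite Hf //; congr State; lia.
Qed.

(* The hypothesis excludes an infinite climb. *)
Lemma explore_column f n a b :
  explore f n = State Enter a b ->
  (forall N, exists t, (N <= t)%N /\
     forall b' : int, explore f t = State Climb a b' -> b' < a%:Z) ->
  exists b', column_step f a b b' /\
    exists2 n', (n < n')%N & explore f n' = State Enter a.+1 b'.
Proof.
(* If the entry site is SW, [b'] is the bottom of the run of SW sites read downwards from [b], which
   is cut off after three sites. If it is NE, [b'] is the first SW site above it. *)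
move=> En Hc; case Fb: (f (a%:Z, b)); last first.
  have E1 : explore f n.+1 = State Descend a (b - 1).
    by rewrite /explore iterS -/(explore f n) En /advance /site /= Fb.
  have E2 : explore f n.+2 = next_state (State Descend a (b - 1)) (f (a%:Z, b - 1)).
    by rewrite /explore iterS -/(explore f n.+1) E1.
  case Fb1: (f (a%:Z, b - 1)).
    exists b; split; last by exists n.+2; rewrite ?E2 ?Fb1 /= ?subrK //; lia.
    split=> c Hc'; first lia.
    have -> : c = b by lia.
    by rewrite Fb.
  have E3 : explore f n.+3 = next_state (State Deeper a (b - 1 - 1)) (f (a%:Z, b - 1 - 1)).
    by rewrite /explore iterS -/(explore f n.+2) E2 Fb1.
  case Fb2: (f (a%:Z, b - 1 - 1)).
    exists (b - 1); split; last first.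
      exists n.+3; first lia.
      by rewrite E3 Fb2 /=; congr State; lia.
    split=> c Hc'; first lia.
    have [->|->] : c = b \/ c = b - 1 by lia.
      by rewrite Fb.
    by rewrite Fb1.
  exists (b - 1 - 1); split; last first.
    by exists n.+3; [lia | rewrite E3 Fb2].
  split=> c Hc'; first lia.
  have [->|[->|->]] : c = b \/ c = b - 1 \/ c = b - 1 - 1 by lia.
  - by rewrite Fb.
  - by rewrite Fb1.
  - by rewrite Fb2.
have [ex|nex] := pselect (exists k, ~~ f (a%:Z, b + k%:Z)).
  case: (ex_minnP ex) => k Fk mink.
  have k0 : (0 < k)%N by case: k Fk {mink} => //; rewrite addr0 Fb.
  have lek j : (j < k)%N -> f (a%:Z, b + j%:Z).
    by move=> jk; apply/negP => /negP /mink; lia.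
  exists (b + k%:Z); split.
    split=> c Hc'.
      have -> : c = b + (absz (c - b))%:Z by lia.
      by apply: lek; lia.
    by have -> : c = b + k%:Z by lia.
  exists (n + k).+1; first lia.
  rewrite /explore iterS -/(explore _ _) (explore_climb En k0 lek).
  by rewrite /advance /site /= (negbTE Fk).
(* In an endless climb the height at time [t] is [b + (t - n)]. The lower bound chosen for [t] makes
   this exceed [a], against [Hc]. *)
exfalso; have allf k : f (a%:Z, b + k%:Z).
  by apply/negP => /negP nf; apply: nex; exists k.
have [t [tN Ht]] := Hc (n + (absz b + a).+1)%N.
have := explore_climb En _ (fun j (_ : (j < t - n)%N) => allf j).
have -> : (n + (t - n) = t)%N by lia.
move=> /(_ ltac:(lia)) /Ht; lia.
Qed.

(** Each column takes at least one step, so column [a] is entered at some time [t >= a]. Bounds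
    known for all late times thereby become bounds for all far columns. *)
Lemma explore_entry_heights f :
  (forall a N, exists t, (N <= t)%N /\
     forall b' : int, explore f t = State Climb a b' -> b' < a%:Z) ->
  exists2 h, entry_heights f h &
    forall a, exists2 t, (a <= t)%N & explore f t = State Enter a (h a).
Proof.
move=> Hc.
have exQ a x n : explore f n = State Enter a x -> exists y, column_step f a x y /\
    exists2 n', (n < n')%N & explore f n' = State Enter a.+1 y.
  by move=> En; apply: explore_column En (Hc a).
pose nx a x := xget 0 [set y | column_step f a x y /\
    exists2 n', (a < n')%N & explore f n' = State Enter a.+1 y].
pose h := fix h (a : nat) := if a is a'.+1 then nx a' (h a') else 0.
have Hh a : exists2 t, (a <= t)%N & explore f t = State Enter a (h a).
  elim: a => [|a [t at_ Et]]; first by exists 0%N.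
  rewrite /= /nx; case: xgetP => [y _ [_ [n' n'a En']]|]; first by exists n'.
  have [y [Hy [n' nn' En']]] := exQ _ _ _ Et.
  by move=> /(_ y) []; split=> //; exists n' => //; lia.
exists h => //; split=> // a; have [t at_ Et] := Hh a.
rewrite /= /nx; case: xgetP => [y _ []//|].
have [y [Hy [n' nn' En']]] := exQ _ _ _ Et.
by move=> /(_ y) []; split=> //; exists n' => //; lia.
Qed.

(** * Bernoulli fields *)

Definition cylinder (T : Type) (F : Z2 -> T -> bool) (l : seq (Z2 * bool)) : set T :=
  [set t | all (fun iv => F iv.1 t == iv.2) l].

Definition bernoulli_field d (T : measurableType d) (R : realType)
    (P : probability T R) (F : Z2 -> T -> bool) (q : R) : Prop :=
  (forall i, measurable [set t | F i t]) /\
  forall l, uniq (unzip1 l) ->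
    P (cylinder F l) = (\prod_(iv <- l) (if iv.2 then q else 1 - q))%:E.

Lemma cylinder_cons (T : Type) (F : Z2 -> T -> bool) i v l :
  cylinder F ((i, v) :: l) = [set t | F i t = v] `&` cylinder F l.
Proof.
apply/seteqP; split => t; rewrite /cylinder /=; first by move=> /andP[/eqP].
by case=> -> ->; rewrite eqxx.
Qed.

Lemma measurable_value d (T : measurableType d) (b : T -> bool) v :
  measurable [set t | b t] -> measurable [set t | b t = v].
Proof.
case: v => // mb; have -> : [set t | b t = false] = ~` [set t | b t].
  by apply/seteqP; split => t /=; case: (b t).
exact: measurableC.
Qed.

Lemma measurable_cylinder d (T : measurableType d) (F : Z2 -> T -> bool) l :
  (forall i, measurable [set t | F i t]) -> measurable (cylinder F l).
Proof.
move=> mF; elim: l => [|[i v] l IH].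
  by rewrite (_ : cylinder _ _ = setT); [exact: measurableT | apply/seteqP].
by rewrite cylinder_cons; apply: measurableI => //; apply: measurable_value.
Qed.

Definition hit (T : Type) (R : realType) (F : Z2 -> T -> bool) (V : state -> R)
    (c : R) (n : nat) (s : state) : set T :=
  [set t | c <= V (iter n (advance (F ^~ t)) s)].

Lemma hitS (T : Type) (R : realType) (F : Z2 -> T -> bool) (V : state -> R) c n s :
  hit F V c n.+1 s =
    ([set t | F (site s) t = true] `&` hit F V c n (next_state s true)) `|`
    ([set t | F (site s) t = false] `&` hit F V c n (next_state s false)).
Proof.
apply/seteqP; split => t; rewrite /hit.
  by rewrite /= -iterS iterSr /advance; case: (F (site s) t) => H; [left|right].
by case=> -[/= E]; rewrite -iterS iterSr /advance E.
Qed.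

Lemma measurable_hit d (T : measurableType d) (R : realType)
    (F : Z2 -> T -> bool) (V : state -> R) c n s :
  (forall i, measurable [set t | F i t]) -> measurable (hit F V c n s).
Proof.
move=> mF; elim: n s => [|n IH] s.
  have [h|h] := pselect (c <= V s).
    by rewrite (_ : hit _ _ _ _ _ = setT); [exact: measurableT | apply/seteqP; split].
  by rewrite (_ : hit _ _ _ _ _ = set0); [exact: measurable0 | apply/seteqP; split].
rewrite hitS; apply: measurableU; apply: measurableI => //; exact: measurable_value.
Qed.

(* Every step reads a site never read before, so a potential contracted in mean
   at each step decays exponentially in expectation; this is Markov's inequality
   for it, proved conditionally on the sites read so far. *)
Lemma hit_bound d (T : measurableType d) (R : realType) (P : probability T R)
    (F : Z2 -> T -> bool) (q : R) (V : state -> R) (rho c : R) :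
  bernoulli_field P F q -> 0 <= q <= 1 -> 0 <= rho -> 0 < c ->
  (forall s, 0 <= V s) ->
  (forall s, q * V (next_state s true) + (1 - q) * V (next_state s false) <= rho * V s) ->
  forall n s l, uniq (unzip1 l) -> (forall i, i \in unzip1 l -> ~~ future s i) ->
    (P (cylinder F l `&` hit F V c n s) <=
     (\prod_(iv <- l) (if iv.2 then q else 1 - q) * (rho ^+ n * V s / c))%:E)%E.
Proof.
move=> [mF PF] /andP[q0 q1] rho0 c0 V0 HV.
have w0 (l : seq (Z2 * bool)) : 0 <= \prod_(iv <- l) (if iv.2 then q else 1 - q).
  by apply: prodr_ge0 => -[i []] _ //=; rewrite subr_ge0.
elim=> [|n IH] s l ul fl.
  have [h|h] := boolP (c <= V s).
    rewrite (_ : hit _ _ _ _ _ = setT); last by apply/seteqP; split.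
    rewrite setIT PF // lee_fin -[leLHS]mulr1; apply: ler_wpM2l => //.
    by rewrite expr0 mul1r ler_pdivlMr // mul1r.
  rewrite (_ : hit _ _ _ _ _ = set0); last by apply/seteqP; split=> // t; rewrite /hit /= (negbTE h).
  by rewrite setI0 measure0 lee_fin; apply: mulr_ge0; rewrite // expr0 mul1r divr_ge0 // ltW.
(* The induction hypothesis applies to the list extended by the answer [v] at the current site: that
   site is new because it lies in the future of [s], and it lies outside the next future. *)
have step v : (P (cylinder F ((site s, v) :: l) `&` hit F V c n (next_state s v)) <=
   (\prod_(iv <- l) (if iv.2 then q else 1 - q) *
     ((if v then q else 1 - q) * (rho ^+ n * V (next_state s v) / c)))%:E)%E.
  apply: (le_trans (IH _ _ _ _)).
  - rewrite /= ul andbT; apply/negP => /fl; by rewrite future_site.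
  - move=> i; rewrite /= in_cons => /orP[/eqP ->|/fl nf].
      by apply/negP => /future_next[_]; rewrite eqxx.
    by apply: contra nf => /future_next[].
  - by rewrite big_cons /= lee_fin [leRHS]mulrCA !mulrA lexx.
have mI v : measurable (cylinder F l `&` ([set t | F (site s) t = v] `&` hit F V c n (next_state s v))).
  apply: measurableI; first exact: measurable_cylinder.
  by apply: measurableI; [exact: measurable_value | exact: measurable_hit].
rewrite hitS setIUr.
apply: (le_trans (measureU2 _ _ _)).
- exact: mI.
- exact: mI.
have := step true; have := step false.
rewrite !cylinder_cons -!setIA => sf st.
rewrite !(setICA (cylinder F l)).
apply: (le_trans (leeD st sf)).
rewrite -EFinD lee_fin -mulrDr; apply: ler_wpM2l => //.
rewrite !mulrA -mulrDl ler_pM2r ?invr_gt0 //.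
apply: (@le_trans _ _ (rho ^+ n * (q * V (next_state s true) + (1 - q) * V (next_state s false)))).
  by rewrite le_eqVlt; apply/orP; left; apply/eqP; ring.
by rewrite exprSr -mulrA ler_wpM2l // exprn_ge0.
Qed.

(** * Potentials of the exploration *)

Lemma closed_density_ge (R : realType) (r : R) :
  0 <= r ^+ 3 + 2 * r - 1 -> 45 / 100 <= r.
Proof.
move=> r0; rewrite leNgt; apply/negP => rl.
(* The quadratic terms of this product cancel, so that it bounds [r ^+ 3] by an affine function of
   [r]. The root of [r ^ 3 + 2 r = 1] is about 0.4534. *)
have : 0 <= (45 / 100 - r) * (r + 225 / 1000) ^+ 2 by apply: mulr_ge0; [lra | exact: sqr_ge0].
move: r0; rewrite !exprS expr0; nra.
Qed.

Section Potentials.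
Variable (R : realType) (q : R).

Definition rate_base : R := 1001 / 1000.

(* With base 1 + 1/1000 and weights 1 + g/1000 the contraction inequalities are, to
   first order, linear in g; the values of g solve them with some slack. *)
Definition coef_up (p : phase) : R :=
  let r := 1 - q in
  match p with
  | Enter => 1
  | Climb => 1 + (r ^+ 2 + 4 / 100) / 1000
  | Descend => 1 + (3 / 100 - r - r ^+ 2) / 1000
  | Deeper => 1 + (2 / 100 - r) / 1000
  end.

(** Weights for the potential that bounds the heights from below. The upward drift has enough slack
    for constants that serve all [1 - q] between 45/100 and 11/20. *)
Definition coef_down (p : phase) : R :=
  match p with
  | Enter => 1
  | Climb => 1 - 7 / 10000
  | Descend => 1 - 1 / 10000
  | Deeper => 1 - 4 / 10000
  end.

Definition decay : R := 1 - 1 / 10 ^+ 5.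

Lemma rate_base_neq0 : rate_base != 0.
Proof. by apply: lt0r_neq0; rewrite /rate_base; lra. Qed.

Lemma rate_base_gt0 (k : int) : 0 < rate_base ^ k.
Proof. by apply: exprz_gt0; rewrite /rate_base; lra. Qed.

(* [g] is the change of the exponent along each step. *)
Lemma potential_decay (c : phase -> R) (e : state -> int) (g : phase -> bool -> int) :
  (forall s v, e (next_state s v) = e s + g (state_phase s) v) ->
  (forall p, let p' v := state_phase (next_state (State p 0 0) v) in
    q * (c (p' true) * rate_base ^ (g p true)) +
    (1 - q) * (c (p' false) * rate_base ^ (g p false)) <= decay * c p) ->
  forall s, let V s := c (state_phase s) * rate_base ^ (e s) in
    q * V (next_state s true) + (1 - q) * V (next_state s false) <= decay * V s.
Proof.
move=> eg H s /=; rewrite !eg !(expfzDr _ _ rate_base_neq0).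
have Eph v : state_phase (next_state s v) = state_phase (next_state (State (state_phase s) 0 0) v) by case: s v => -[] ? ? [].
rewrite !Eph; move: (H (state_phase s)) => /(ler_wpM2r (ltW (rate_base_gt0 (e s)))) /=.
by rewrite mulrDl -!mulrA ![rate_base ^ (g _ _) * _]mulrC.
Qed.

Lemma potential_up_decay s :
  let V s := coef_up (state_phase s) * rate_base ^ (state_ht s - (state_col s)%:Z) in
  1 - q <= 11 / 20 -> 0 <= (1 - q) ^+ 3 + 2 * (1 - q) - 1 ->
  q * V (next_state s true) + (1 - q) * V (next_state s false) <= decay * V s.
Proof.
move=> V r1 r0.
apply: (potential_decay (c := coef_up) (e := fun s => state_ht s - (state_col s)%:Z) (g := fun p v =>
  match p, v with
  | Enter, true | Climb, true => 1
  | Descend, true | Deeper, true => 0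
  | _, false => - 1
  end)) => [[] [] a b [] /=|p]; try by clear; lia.
have zE : rate_base^-1 = 1000 / 1001 by rewrite /rate_base invf_div.
have rl := closed_density_ge r0.
rewrite /coef_up; move: (1 - q) (subKr 1 q) r1 r0 rl => r {V} <- r1 r0 rl.
have r2 : 20 / 100 <= r ^+ 2 <= 31 / 100 by apply/andP; split; nra.
(* To first order the inequality at [Enter] is [104/100 - 201/100 r - 2 r ^ 3 <= - 1/100]. The
   hypothesis absorbs [1 - 2 r - r ^ 3]; the second [r ^ 3], due to looking down by two sites, pays
   for the remaining constants. *)
have r3 : 9 / 100 <= r ^+ 3 by rewrite exprS; nra.
case: p => /=; rewrite ?expr1z ?expr0z ?exprN1 zE /rate_base /decay /=; lra.
Qed.

Lemma potential_down_decay s :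
  let V s := coef_down (state_phase s) * rate_base ^ (- state_ht s) in
  45 / 100 <= 1 - q <= 11 / 20 ->
  q * V (next_state s true) + (1 - q) * V (next_state s false) <= decay * V s.
Proof.
move=> V /andP[rl r1].
apply: (potential_decay (c := coef_down) (e := fun s => - state_ht s) (g := fun p v =>
  match p, v with
  | _, true => - 1
  | Enter, false | Descend, false => 1
  | _, false => 0
  end)) => [[] [] a b [] /=|p]; try by clear; lia.
have zE : rate_base^-1 = 1000 / 1001 by rewrite /rate_base invf_div.
move: (1 - q) (subKr 1 q) r1 rl => r {V} <- r1 rl.
case: p => /=; rewrite ?expr1z ?expr0z ?exprN1 zE /rate_base /decay /=; lra.
Qed.

End Potentials.

(** * Regular environments: entry heights of linear growth *)

Definition sup_norm (u : Z2) : nat := maxn (absz u.1) (absz u.2).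

Definition box (n : nat) : seq Z2 :=
  [seq (i%:Z - n%:Z, j%:Z - n%:Z) | i <- iota 0 (n.*2.+1), j <- iota 0 (n.*2.+1)].

Lemma mem_box n u : (u \in box n) = (sup_norm u <= n)%N.
Proof.
case: u => x y; rewrite /sup_norm /=; apply/allpairsP/idP => [[[i j] []]|xyn].
  by rewrite !mem_iota => /= ? ? [-> ->]; lia.
exists (absz (x + n%:Z), absz (y + n%:Z)); rewrite !mem_iota /=.
by split; [lia | lia | apply/eqP; rewrite xpair_eqE; lia].
Qed.

Lemma size_box n : size (box n) = (n.*2.+1 * n.*2.+1)%N.
Proof. by rewrite size_allpairs size_iota. Qed.

(* The environment [e] as seen from [u] by a walker heading north-west, whose
   columns are numbered leftwards. *)
Definition view (e : Z2 -> bool) (u : Z2) : Z2 -> bool :=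
  fun i => e (u.1 - i.1, u.2 + i.2).

(** The speed bounds [a / m < h a < (1 - 1 / m) a], written without division. The factor 2 in the
    range of starting points leaves room to start a second walk at the end of a first one. *)
Definition regular (m : nat) (e : Z2 -> bool) : Prop :=
  exists N0 : nat, forall u, exists2 h, entry_heights (view e u) h &
    forall a, (N0 <= a)%N -> (sup_norm u <= 2 * m * a)%N ->
      a%:Z < m%:Z * h a /\ a%:Z < m%:Z * (a%:Z - h a).

Section Rates.
Variable R : realType.

(** Strictly between [decay] and 1: [decay / threshold] still gives summable probabilities, while a
    potential below [threshold ^+ t] forces an exponent of linear size. *)
Definition threshold : R := 1 - 5 / 10 ^+ 6.

Lemma threshold_gt0 : 0 < threshold.
Proof. by rewrite /threshold; lra. Qed.

Lemma threshold_le1 : threshold <= 1.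
Proof. by rewrite /threshold; lra. Qed.

Lemma bernoulli_inequality (x : R) n : 0 <= x -> 1 + n%:R * x <= (1 + x) ^+ n.
Proof.
move=> x0; elim: n => [|n IH]; first by rewrite mul0r addr0 expr0.
rewrite exprS; apply: (@le_trans _ _ ((1 + x) * (1 + n%:R * x))).
  have : 0 <= n%:R * x * x by rewrite !mulr_ge0.
  rewrite -natr1; lra.
by rewrite ler_wpM2l // addr_ge0.
Qed.

(** With [x = 5 / 10 ^ 6] the base is [1 + 200 x], at most [(1 + x) ^ 200], and
    [threshold * (1 + x) = 1 - x ^ 2]. The inverse of [m] becomes the speed. *)
Lemma threshold_rate_base : exists m : nat, threshold ^+ m * rate_base R <= 1.
Proof.
exists 200%N; pose x : R := 5 / 10 ^+ 6.
have x0 : 0 <= x by rewrite /x; lra.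
have := bernoulli_inequality 200 x0.
have -> : 1 + 200%:R * x = rate_base R by rewrite /x /rate_base; lra.
move=> H; apply: le_trans (_ : threshold ^+ 200 * (1 + x) ^+ 200 <= 1).
  by rewrite ler_wpM2l // exprn_ge0 // ltW // threshold_gt0.
rewrite -exprMn; apply: exprn_ile1; rewrite /threshold /x; lra.
Qed.

Lemma threshold_rate_base_gt0 m : threshold ^+ m * rate_base R <= 1 -> (0 < m)%N.
Proof. by case: m => //; rewrite expr0 mul1r /rate_base; lra. Qed.

(** If [m k <= a <= t] with [k >= 0], then [threshold ^+ t <= threshold ^+ (m k)], which is at most
    the power of the base with exponent [- k]. For [k < 0] that power is at least 1. *)
Lemma linear_of_decay (m a t : nat) (k : int) :
  threshold ^+ m * rate_base R <= 1 -> (a <= t)%N ->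
  rate_base R ^ (- k) < threshold ^+ t -> a%:Z < m%:Z * k.
Proof.
move=> Hm at_ Hk; rewrite ltNge; apply/negP => ka.
have t01 : 0 <= threshold <= 1 by rewrite threshold_le1 ltW // threshold_gt0.
have z1 : 1 <= rate_base R by rewrite /rate_base; lra.
move: Hk; apply/negP; rewrite -leNgt.
case: k ka => [k|k] ka.
  apply: (@le_trans _ _ ((threshold ^+ m) ^+ k)).
    rewrite -exprM; apply: ler_wiXn2l; [by case/andP: t01|by case/andP: t01|lia].
  rewrite -exprnN -exprVn.
  have t0 : 0 <= threshold by case/andP: t01.
  apply: lerXn2r; rewrite ?nnegrE ?exprn_ge0 //; first by rewrite invr_ge0; lra.
  by rewrite -[leRHS]mul1r ler_pdivlMr //; lra.
apply: (@le_trans _ _ 1); first by apply: exprn_ile1; case/andP: t01.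
by rewrite NegzE opprK -exprnP exprn_ege1.
Qed.

Lemma coef_up_climb (q : R) : 1 <= coef_up q Climb.
Proof. by rewrite /coef_up; have := sqr_ge0 (1 - q); lra. Qed.

Definition slow (q : R) (e : Z2 -> bool) (t : nat) (u : Z2) : Prop :=
  let s := explore (view e u) t in
  coef_up q (state_phase s) * rate_base R ^ (state_ht s - (state_col s)%:Z) < threshold ^+ t /\
  coef_down R (state_phase s) * rate_base R ^ (- state_ht s) < threshold ^+ t.

Lemma regular_of_slow (q : R) (e : Z2 -> bool) (m : nat) :
  threshold ^+ m * rate_base R <= 1 ->
  (exists N0, forall t, (N0 <= t)%N -> forall u, u \in box (2 * m * t) -> slow q e t u) ->
  regular m e.
Proof.
move=> Hm [N0 H]; exists N0 => u; have m0 := threshold_rate_base_gt0 Hm.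
have [|h Hh Eh] := @explore_entry_heights (view e u).
  move=> a N; exists (maxn N (maxn N0 (sup_norm u))); split; first lia.
  move=> b' Et; set t := maxn _ _ in Et.
  have [||+ _] := H t _ u; rewrite ?mem_box; [lia | rewrite /t; nia|].
  (* No endless climb: at height [a] or more in column [a] a climbing state has potential at least
     1, whereas [threshold R ^+ t] is at most 1. *)
  rewrite Et /= -/(coef_up q Climb) => Hb; rewrite ltNge; apply/negP => ab.
  move: Hb; apply/negP; rewrite -leNgt; apply: (@le_trans _ _ 1).
    by apply: exprn_ile1; rewrite ?threshold_le1 // ltW // threshold_gt0.
  have -> : b' - a%:Z = (absz (b' - a%:Z))%:Z by lia.
  rewrite -[leLHS]mul1r; apply: ler_pM => //; first exact: coef_up_climb.
  by rewrite -exprnP exprn_ege1 //; rewrite /rate_base; lra.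
(* Since [a <= t], the range [2 * m * a] allowed for [u] is inside the box of time [t]. *)
exists h => // a Na ua; have [t at_ Et] := Eh a.
have [||] := H t _ u; rewrite ?mem_box; [lia | nia |].
rewrite Et /= !mul1r => H1 H2; split; first exact: (linear_of_decay Hm at_ H2).
by apply: (linear_of_decay Hm at_); rewrite opprB.
Qed.
End Rates.

(** * Almost sure regularity *)

Lemma bernoulli_field_inj d (T : measurableType d) (R : realType)
    (P : probability T R) (F : Z2 -> T -> bool) (q : R) (g : Z2 -> Z2) :
  injective g -> bernoulli_field P F q -> bernoulli_field P (F \o g) q.
Proof.
move=> gi [mF PF]; split=> [i|l ul]; first exact: mF.
have := PF [seq (g iv.1, iv.2) | iv <- l].
have -> : unzip1 [seq (g iv.1, iv.2) | iv <- l] = map g (unzip1 l).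
  by rewrite /unzip1 -!map_comp.
rewrite map_inj_uniq // => /(_ ul); rewrite big_map /= => <-.
by congr (P _); apply/seteqP; split => t; rewrite /cylinder /= all_map.
Qed.

Lemma bernoulli_field_neg d (T : measurableType d) (R : realType)
    (P : probability T R) (F : Z2 -> T -> bool) (q : R) :
  bernoulli_field P F q -> bernoulli_field P (fun i t => ~~ F i t) (1 - q).
Proof.
move=> [mF PF]; split=> [i|l ul].
  rewrite (_ : [set t | _] = ~` [set t | F i t]); first exact: measurableC.
  by apply/seteqP; split => t /= /negP.
have := PF [seq (iv.1, ~~ iv.2) | iv <- l].
have -> : unzip1 [seq (iv.1, ~~ iv.2) | iv <- l] = unzip1 l.
  by rewrite /unzip1 -!map_comp.
move=> /(_ ul); rewrite big_map /= => PE.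
have -> : cylinder (fun i t => ~~ F i t) l = cylinder F [seq (iv.1, ~~ iv.2) | iv <- l].
  apply/seteqP; split => t; rewrite /cylinder /= all_map; apply: sub_all => -[i []] /=;
  by case: (F i t).
by rewrite PE; congr (_%:E); apply: eq_bigr => -[i []] _ //=; rewrite subKr.
Qed.

Lemma borel_cantelli_geometric d (T : measurableType d) (R : realType)
    (P : probability T R) (E : nat -> set T) (C s : R) :
  (forall n, measurable (E n)) -> 0 <= C -> 0 < s < 1 ->
  (forall n, (P (E n) <= (C * s ^+ n)%:E)%E) ->
  {ae P, forall t, exists N, forall n, (N <= n)%N -> ~ E n t}.
Proof.
move=> mE C0 /andP[s0 s1] PE.
exists (lim_sup_set E); split.
- apply: bigcap_measurable => // k _; exact: bigcup_measurable.
- apply: lim_sup_set_cvg0 => //.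
  apply: (@le_lt_trans _ _ (C * (1 - s)^-1)%:E); last exact: ltry.
  apply: lime_le; first by apply: is_cvg_nneseries.
  apply: nearW => n; apply: (@le_trans _ _ (series (geometric C s) n)%:E).
    by rewrite /series /= -sumEFin; apply: lee_sum => i _; exact: PE.
  by rewrite lee_fin; apply: geometric_le_lim => //; rewrite gtr0_norm.
- move=> t /= H n _; apply: contrapT => nH; apply: H; exists n => k nk Ek.
  by apply: nH; exists k.
Qed.

Lemma measure_bigsetU_le d (T : measurableType d) (R : realType)
    (P : probability T R) (I : eqType) (l : seq I) (E : I -> set T) (c : R) :
  (forall i, measurable (E i)) -> (forall i, (P (E i) <= c%:E)%E) ->
  (P (\big[setU/set0]_(i <- l) E i) <= ((size l)%:R * c)%:E)%E.
Proof.
move=> mE PE; elim: l => [|i l IH]; first by rewrite big_nil measure0 mul0r.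
rewrite big_cons; apply: (le_trans (measureU2 _ _ _)) => //.
  by apply: bigsetU_measurable.
apply: (le_trans (leeD (PE i) IH)).
by rewrite -EFinD lee_fin /= -natr1; lra.
Qed.

Lemma hit_explore_bound d (T : measurableType d) (R : realType)
    (P : probability T R) (F : Z2 -> T -> bool) (q : R) (V : state -> R) (t : nat) :
  bernoulli_field P F q -> 0 <= q <= 1 ->
  (forall s, 0 <= V s) -> V (State Enter 0 0) = 1 ->
  (forall s, q * V (next_state s true) + (1 - q) * V (next_state s false) <= decay R * V s) ->
  (P (hit F V (threshold R ^+ t) t (State Enter 0 0)) <=
    ((decay R / threshold R) ^+ t)%:E)%E.
Proof.
move=> FF q01 V0 V1 HV.
have d0 : 0 <= decay R by rewrite /decay; lra.
have c0 : 0 < threshold R ^+ t by rewrite exprn_gt0 // threshold_gt0.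
have := hit_bound FF q01 d0 c0 V0 HV t (s := State Enter 0 0) (l := [::]) isT.
rewrite (_ : cylinder F [::] = setT); last by apply/seteqP; split.
by rewrite setTI big_nil mul1r V1 mulr1 expr_div_n; apply.
Qed.

(** The left side is the side length of the box of starting points at time [t]; an exponential of
    arbitrarily small rate absorbs it in the union bound. *)
Lemma growth_bound (R : realType) (m t : nat) (x : R) : 0 < x <= 1 ->
  ((4 * m * t).+1)%:R <= (4 * m).+1%:R / x * (1 + x) ^+ t.
Proof.
move=> /andP[x0 x1]; have H := bernoulli_inequality t (ltW x0).
apply: (@le_trans _ _ ((4 * m).+1%:R * t.+1%:R)).
  by rewrite -natrM ler_nat; nia.
rewrite -mulrA ler_wpM2l // -[leLHS](mulKf (lt0r_neq0 x0)) ler_wpM2l ?invr_ge0 ?(ltW x0) //.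
apply: le_trans H; rewrite -natr1 mulrDr mulr1 addrC lerD // mulrC //.
Qed.

Lemma regular_ae d (T : measurableType d) (R : realType) (P : probability T R)
    (F : Z2 -> T -> bool) (q : R) (m : nat) :
  threshold R ^+ m * rate_base R <= 1 -> bernoulli_field P F q ->
  1 - q <= 11 / 20 -> 0 <= (1 - q) ^+ 3 + 2 * (1 - q) - 1 ->
  {ae P, forall w, regular m (F ^~ w)}.
Proof.
move=> Hm FF r1 r0; have rl := closed_density_ge r0.
have q01 : 0 <= q <= 1 by lra.
pose G u i := F (u.1 - i.1, u.2 + i.2).
have GF u : bernoulli_field P (G u) q.
  apply: (bernoulli_field_inj (g := fun i => (u.1 - i.1, u.2 + i.2)) _ FF) => -[x y] [x' y'] /= [? ?].
  by apply/eqP; rewrite xpair_eqE; apply/andP; split; apply/eqP; lia.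
pose V1 s := coef_up q (state_phase s) * rate_base R ^ (state_ht s - (state_col s)%:Z).
pose V2 s := coef_down R (state_phase s) * rate_base R ^ (- state_ht s).
have V10 s : 0 <= V1 s.
  rewrite mulr_ge0 ?ltW ?rate_base_gt0 //.
  case: (state_phase s); rewrite /coef_up; move: (1 - q) rl r1 => r rl r1; nra.
have V20 s : 0 <= V2 s.
  by rewrite mulr_ge0 ?ltW ?rate_base_gt0 //; case: (state_phase s); rewrite /coef_down; lra.
pose s0 := State Enter 0 0.
pose B t u := hit (G u) V1 (threshold R ^+ t) t s0 `|` hit (G u) V2 (threshold R ^+ t) t s0.
have mB t u : measurable (B t u).
  by apply: measurableU; apply: measurable_hit; case: (GF u).
pose D t := \big[setU/set0]_(u <- box (2 * m * t)) B t u.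
have PB t u : (P (B t u) <= (2 * (decay R / threshold R) ^+ t)%:E)%E.
  apply: (le_trans (measureU2 _ _ _)).
  - by apply: measurable_hit; case: (GF u).
  - by apply: measurable_hit; case: (GF u).
  rewrite mulr_natl mulr2n EFinD; apply: leeD.
  - apply: (hit_explore_bound t (GF u) q01) => //; first by rewrite /V1 /= mul1r.
    by move=> s; exact: potential_up_decay.
  - apply: (hit_explore_bound t (GF u) q01) => //; first by rewrite /V2 /= mul1r.
    by move=> s; apply: potential_down_decay; rewrite rl.
(* [x] is small enough that the factor [(1 + x) ^+ 2] per unit of time, due to the area of the box,
   keeps the ratio below 1. *)
pose x : R := 1 / 10 ^+ 6; have x01 : 0 < x <= 1 by rewrite /x; lra.
have := @borel_cantelli_geometric _ _ _ P D
    (2 * ((4 * m).+1%:R / x) ^+ 2) (decay R / threshold R * (1 + x) ^+ 2).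
move=> /(_ _ _ _ _)BC; apply: filterS (BC _ _ _ _).
- move=> w [N0 HN]; apply: (regular_of_slow (q := q) Hm); exists N0 => t tN u ub.
  have nB : ~ B t u w by move=> Bw; apply: (HN t tN); rewrite /D -bigcup_seq; exists u.
  by split; rewrite ltNge; apply/negP => H; apply: nB; [left|right].
- by move=> t; apply: bigsetU_measurable.
- by rewrite mulr_ge0 // sqr_ge0.
- have t0 := threshold_gt0 R; apply/andP; split.
    by rewrite mulr_gt0 ?exprn_gt0 ?divr_gt0 // /decay /x; lra.
  by rewrite mulrAC ltr_pdivrMr // mul1r /decay /threshold /x; lra.
- move=> t; apply: (le_trans (measure_bigsetU_le _ _ (PB t))) => //.
  have E (a b c : R) : 2 * a ^+ 2 * (b * c ^+ 2) ^+ t = (2 * b ^+ t) * (a * c ^+ t) ^+ 2.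
    by rewrite exprMn -exprM mulnC exprM; move: (b ^+ t) (c ^+ t) => b' c'; ring.
  rewrite lee_fin size_box E.
  rewrite mulrC ler_wpM2l //.
    by rewrite mulr_ge0 // exprn_ge0 // divr_ge0 // ?(ltW (threshold_gt0 R)) // /decay; lra.
  rewrite natrM -expr2; apply: lerXn2r; rewrite ?nnegrE //.
    by rewrite mulr_ge0 ?exprn_ge0 ?divr_ge0 // /x; lra.
  by have := growth_bound m t x01; rewrite (_ : (_ * t)%N = (2 * m * t).*2) //; lia.
Qed.

(** * Triangular clusters *)

(** Reflection in the line [x + y = 0]. It exchanges left and up, so it preserves the triangular
    edges and turns rows into columns. *)
Definition antitranspose (e : Z2 -> bool) : Z2 -> bool := fun z => e (- z.2, - z.1).

(** An open site has outgoing edges only if it is strictly below the exit height, so a step up by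
    one in this or the next column does not overtake the exploration. *)
Lemma column_step_open f a h h' (b : int) :
  column_step f a h h' -> f (a%:Z, b) -> b <= Num.max h h' -> b < h'.
Proof.
by move=> [_ cl] fb bm; rewrite ltNge; apply/negP => hb; move: (cl b); rewrite hb bm fb => /(_ isT).
Qed.

Lemma finite_box n : finite_set [set z | z \in box n].
Proof. exact: finite_seq. Qed.

Lemma triangular_edgeP op x y : triangular_edge op x y ->
  op x /\ [\/ y = (x.1 - 1, x.2), y = (x.1, x.2 + 1) | y = (x.1 - 1, x.2 + 1)].
Proof.
case: x y => x1 x2 [y1 y2] /andP[-> H]; split=> //; move: H.
rewrite !inE /e1 /e2 => /or3P[] /eqP [-> ->]; rewrite /= ?addr0 ?subr0 ?oppr0 ?addr0.
- by constructor 1.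
- by constructor 2.
- by constructor 3.
Qed.

Lemma regular_triangular_finite (m : nat) (op : Z2 -> bool) :
  regular m op -> regular m (antitranspose op) -> finite_set (triangular_cluster op).
Proof.
move=> [N /(_ 0)[h [h0 Hh] Hm]] [N' /(_ 0)[k [k0 Hk] Hm']].
pose M := (maxn N N').+1.
have hlt a : (M <= a)%N -> h a < a%:Z.
  by move=> Ma; have [|//|] := Hm a; [lia | nia].
have klt a : (M <= a)%N -> k a < a%:Z.
  by move=> Ma; have [|//|] := Hm' a; [lia | nia].
(* The cluster point is [(- a, b)]. The third clause persists because at an open site [b < h a.+1]
   and [a < k b.+1]: if both coordinates had passed [M], these would give both [b < a] and
   [a < b]. *)
pose inv (a b : nat) := [/\ b%:Z <= Num.max (h a) (h a.+1),
  a%:Z <= Num.max (k b) (k b.+1) & (a < M)%N || (b < M)%N].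
have inv0 : inv 0%N 0%N by rewrite /inv h0 k0; split; lia.
have step z z' a b : inv a b -> z = (- a%:Z, b%:Z) -> triangular_edge op z z' ->
    exists a' b', inv a' b' /\ z' = (- a'%:Z, b'%:Z).
  move=> [I1 I2 I3] -> /triangular_edgeP[] /= opz.
  have bh : b%:Z < h a.+1.
    by apply: column_step_open (Hh a) _ I1; rewrite /view /= sub0r add0r.
  have ak : a%:Z < k b.+1.
    by apply: column_step_open (Hk b) _ I2; rewrite /view /antitranspose /= sub0r add0r opprK.
  have := hlt a.+1; have := klt b.+1 => kb ha.
  case=> ->.
  - exists a.+1, b; split; last by congr pair; lia.
    split; lia.
  - exists a, b.+1; split; last by congr pair; lia.
    split; lia.
  - exists a.+1, b.+1; split; last by congr pair; lia.
    split; lia.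
pose B := (M + \sum_(i < M.+1) (absz (h i) + absz (k i)))%N.
have hB i : (i <= M)%N -> h i <= B%:Z /\ k i <= B%:Z.
  move=> iM; have iM' : (i < M.+1)%N by [].
  by rewrite /B (bigD1 (Ordinal iM')) //=; lia.
apply: (sub_finite_set _ (finite_box B)) => z [s [ps <-]] /=.
have [a [b [I ->]]] : exists a b, inv a b /\ last 0 s = (- a%:Z, b%:Z).
  have : exists a b, inv a b /\ (0 : Z2) = (- a%:Z, b%:Z) by exists 0%N, 0%N.
  elim: s (0 : Z2) ps => [|y s IH] x //= /andP[xy ps] [a [b [I Ex]]].
  exact: IH ps (step _ _ _ _ I Ex xy).
rewrite mem_box /sup_norm /=; case: I => I1 I2 I3.
have aB : (a < M)%N -> (a <= B)%N /\ (b <= B)%N.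
  by move=> aM; have [? ?] := hB a (ltnW aM); have [? ?] := hB a.+1 aM; rewrite /B; lia.
have bB : (b < M)%N -> (a <= B)%N /\ (b <= B)%N.
  by move=> bM; have [? ?] := hB b (ltnW bM); have [? ?] := hB b.+1 bM; rewrite /B; lia.
lia.
Qed.

(** * Caps and cups in the orthant model *)

Definition orthant_edge (e : Z2 -> bool) : rel Z2 := fun x y =>
  y \in (if e x then [:: x + e1; x + e2] else [:: x - e1; x - e2]).

Definition edge_closed (e : Z2 -> bool) (C : set Z2) : Prop :=
  forall x y, C x -> orthant_edge e x y -> C y.

Definition transpose (e : Z2 -> bool) : Z2 -> bool := fun z => e (z.2, z.1).
(** A half-turn exchanges the site types NE and SW, hence the negation. *)
Definition rotate (e : Z2 -> bool) : Z2 -> bool := fun z => ~~ e (- z.1, - z.2).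

Lemma orthant_edgeP e x1 x2 (y : Z2) : orthant_edge e (x1, x2) y <->
  if e (x1, x2) then y = (x1 + 1, x2) \/ y = (x1, x2 + 1)
  else y = (x1 - 1, x2) \/ y = (x1, x2 - 1).
Proof.
case: y => y1 y2; rewrite /orthant_edge; case: (e _); rewrite !inE /e1 /e2 !xpair_eqE /=;
split.
- by move=> /orP[/andP[/eqP-> /eqP->]|/andP[/eqP-> /eqP->]]; rewrite !addr0; [left|right].
- by case=> -[-> ->]; rewrite !addr0 !eqxx ?orbT.
- by move=> /orP[/andP[/eqP-> /eqP->]|/andP[/eqP-> /eqP->]]; rewrite !subr0; [left|right].
- by case=> -[-> ->]; rewrite !subr0 !eqxx ?orbT.
Qed.

Lemma transpose_closed e C : edge_closed e C ->
  edge_closed (transpose e) [set z | C (z.2, z.1)].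
Proof.
move=> H [x1 x2] [y1 y2] /= Cx /orthant_edgeP; rewrite /transpose /= => E.
apply: (H (x2, x1)) => //; apply/orthant_edgeP; move: E.
by case: (e _) => -[[-> ->]|[-> ->]]; [right|left|right|left].
Qed.

Lemma rotate_closed e C : edge_closed e C ->
  edge_closed (rotate e) [set z | C (- z.1, - z.2)].
Proof.
move=> H [x1 x2] [y1 y2] /= Cx /orthant_edgeP; rewrite /rotate /= => E.
apply: (H (- x1, - x2)) => //; apply/orthant_edgeP; move: E.
by case: (e _) => /= -[[-> ->]|[-> ->]]; rewrite ?opprD ?opprK; [left|right|left|right].
Qed.

(** The exploration is followed by a path of the environment: NE sites carry it up a column, SW
    sites carry it down, and the exit site is SW and allows the step left. *)
Lemma closed_entry e C u h : edge_closed e C -> C u ->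
  entry_heights (view e u) h ->
  forall a (b : int), Num.min (h a) (h a.+1) <= b <= Num.max (h a) (h a.+1) ->
    C (u.1 - a%:Z, u.2 + b).
Proof.
case: u => u1 u2 Ce Cu [h0 Hh] /=.
have seg a : C (u1 - a%:Z, u2 + h a) ->
    (forall b, Num.min (h a) (h a.+1) <= b <= Num.max (h a) (h a.+1) ->
      C (u1 - a%:Z, u2 + b)) /\ C (u1 - a.+1%:Z, u2 + h a.+1).
  move=> Ca; have [op cl] := Hh a; rewrite /view /= in op cl.
  have S b : Num.min (h a) (h a.+1) <= b <= Num.max (h a) (h a.+1) ->
      C (u1 - a%:Z, u2 + b).
    have [le|lt] := leP (h a) (h a.+1) => bI.
      have : b = h a + (absz (b - h a))%:Z by lia.
      move: (absz _) bI => n bI bE; rewrite {}bE in bI *.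
      elim: n bI => [|n IH] bI; first by rewrite addr0.
      apply: (Ce (u1 - a%:Z, u2 + (h a + n%:Z))); first by apply: IH; lia.
      by apply/orthant_edgeP; rewrite op; [right; congr pair; lia|lia].
    have : b = h a - (absz (h a - b))%:Z by lia.
    move: (absz _) bI => n bI bE; rewrite {}bE in bI *.
    elim: n bI => [|n IH] bI; first by rewrite subr0.
    apply: (Ce (u1 - a%:Z, u2 + (h a - n%:Z))); first by apply: IH; lia.
    apply/orthant_edgeP; rewrite (negbTE (cl _ _)); [right; congr pair; lia|lia].
  split=> //; apply: (Ce (u1 - a%:Z, u2 + h a.+1)); first by apply: S; lia.
  by apply/orthant_edgeP; rewrite (negbTE (cl _ _)); [left; congr pair; lia|lia].
have ent a : C (u1 - a%:Z, u2 + h a).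
  elim: a => [|a IH]; first by rewrite h0 subr0 addr0.
  by have [] := seg a IH.
by move=> a; have [] := seg a (ent a).
Qed.

Lemma closed_entry0 e C u h a : edge_closed e C -> C u ->
  entry_heights (view e u) h -> C (u.1 - a%:Z, u.2 + h a).
Proof. by move=> Ce Cu Hh; apply: closed_entry Ce Cu Hh _ _ _; lia. Qed.

(** The region under the cap made of the north-west walk [h] and the south-east walk [k] from [u],
    the latter read row by row in transposed coordinates. The last clause cuts off the open quadrant
    north-east of [u], which neither walk bounds. *)
Definition below (u : Z2) (h k : nat -> int) (z : Z2) : Prop :=
  [/\ z.1 <= u.1 -> z.2 < u.2 + h (absz (u.1 - z.1)),
      z.2 <= u.2 -> z.1 < u.1 + k (absz (u.2 - z.2)) &
      ~ (u.1 < z.1 /\ u.2 < z.2)].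

Lemma adjacentP x1 x2 (y : Z2) : Defs.adjacent (x1, x2) y ->
  [\/ y = (x1 - 1, x2), y = (x1 + 1, x2), y = (x1, x2 - 1) | y = (x1, x2 + 1)].
Proof.
case: y => y1 y2; rewrite /Defs.adjacent !inE /e1 /e2 !xpair_eqE /= => H.
have [[? ?]|[[? ?]|[[? ?]|[? ?]]]] : (y1 - x1 = 1 /\ y2 - x2 = 0) \/
   (y1 - x1 = -1 /\ y2 - x2 = 0) \/ (y1 - x1 = 0 /\ y2 - x2 = 1) \/
   (y1 - x1 = 0 /\ y2 - x2 = -1) by lia.
- by constructor 2; congr pair; lia.
- by constructor 1; congr pair; lia.
- by constructor 4; congr pair; lia.
- by constructor 3; congr pair; lia.
Qed.

Lemma below_sym u h k z : below u h k z <-> below (u.2, u.1) k h (z.2, z.1).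
Proof. by split=> -[A B D]; split=> //= -[? ?]; apply: D. Qed.

(** Column [a] of the north-west walk contains the whole segment between [h a] and [h a.+1], so a
    site outside [C] under one end is under both. Across the other walk, a horizontal step would
    have to land on its entry site in that row, which is in [C]. *)
Lemma below_horizontal e C u h k z1 z2 z1' :
  edge_closed e C -> C u ->
  entry_heights (view e u) h ->
  entry_heights (view (transpose e) (u.2, u.1)) k ->
  ~ C (z1, z2) -> ~ C (z1', z2) -> z1' = z1 - 1 \/ z1' = z1 + 1 ->
  below u h k (z1, z2) -> below u h k (z1', z2).
Proof.
move=> Ce Cu Hh Hk nz nz' zz.
have CH := closed_entry Ce Cu Hh; have h0 := Hh.1.
have Cu' : [set z | C (z.2, z.1)] (u.2, u.1) by case: u Cu {Hh Hk CH}.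
have CK a := closed_entry0 a (transpose_closed Ce) Cu' Hk.
rewrite /below /= in CK * => -[A B D].
have nH a x : ~ C (x, z2) -> x = u.1 - a%:Z ->
    ~~ (Num.min (h a) (h a.+1) <= z2 - u.2 <= Num.max (h a) (h a.+1)).
  move=> nxy Ex; apply/negP => /CH; rewrite -Ex.
  by have -> : u.2 + (z2 - u.2) = z2 by lia.
split=> [z1u|z2u|[z1u z2u]].
- case: zz => Ez.
    have [zu|zu] := leP z1 u.1.
      have := nH _ z1 nz (_ : _ = u.1 - (absz (u.1 - z1))%:Z).
      move=> /(_ ltac:(lia)); have := A zu.
      have -> : absz (u.1 - z1') = (absz (u.1 - z1)).+1 by lia.
      lia.
    have z1E : z1' = u.1 by lia.
    have := nH 0%N z1' nz' ltac:(lia); rewrite h0.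
    have -> : absz (u.1 - z1') = 0%N by lia.
    rewrite h0; have : ~ (u.2 < z2) by move=> ?; apply: D; split; lia.
    lia.
  have zu : z1 <= u.1 by lia.
  have := nH _ z1' nz' (_ : _ = u.1 - (absz (u.1 - z1'))%:Z).
  move=> /(_ ltac:(lia)); have := A zu.
  have -> : absz (u.1 - z1) = (absz (u.1 - z1')).+1 by lia.
  lia.
- have := B z2u; case: zz => Ez; first lia.
  have : z1' <> u.1 + k (absz (u.2 - z2)); last lia.
  move=> E; apply: nz'; rewrite E.
  by have := CK (absz (u.2 - z2)); have -> : u.2 - (absz (u.2 - z2))%:Z = z2 by lia.
- have [zu|zu] := leP z1 u.1; last by apply: D.
  have := A zu; have -> : absz (u.1 - z1) = 0%N by lia.
  rewrite h0; lia.
Qed.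

Lemma below_adjacent e C u h k z z' :
  edge_closed e C -> C u ->
  entry_heights (view e u) h ->
  entry_heights (view (transpose e) (u.2, u.1)) k ->
  ~ C z -> ~ C z' -> Defs.adjacent z z' -> below u h k z -> below u h k z'.
Proof.
case: z => z1 z2 Ce Cu Hh Hk nz nz' /adjacentP adj.
have hor x : z' = (x, z2) -> x = z1 - 1 \/ x = z1 + 1 -> below u h k (z1, z2) -> below u h k z'.
  by move=> Ez; rewrite {}Ez in nz' *; exact: below_horizontal Ce Cu Hh Hk nz nz'.
have ver y : z' = (z1, y) -> y = z2 - 1 \/ y = z2 + 1 -> below u h k (z1, z2) -> below u h k z'.
  move=> Ez yz; rewrite {}Ez in nz' *; rewrite !(below_sym u) /=.
  apply: (below_horizontal (transpose_closed Ce) (u := (u.2, u.1)) _ Hk) yz => //.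
  by case: u Cu {Hh Hk hor}.
by case: adj => E; [apply: hor E _ | apply: hor E _ | apply: ver E _ | apply: ver E _]; auto.
Qed.

Lemma below_component e C u h k y :
  edge_closed e C -> C u ->
  entry_heights (view e u) h ->
  entry_heights (view (transpose e) (u.2, u.1)) k ->
  below u h k y -> forall z, lattice_component (~` C) y z -> below u h k z.
Proof.
move=> Ce Cu Hh Hk By z [s [ps <- nC]]; elim: s y ps nC By => //= x s IH y.
move=> /andP[yx ps] nC By; apply: IH => //.
  by move=> z' zs; apply: nC; rewrite in_cons zs orbT.
apply: (below_adjacent Ce Cu Hh Hk _ _ yx By); apply: nC; rewrite !in_cons eqxx ?orbT //.
Qed.

(** The hypotheses say that far out the cap runs through sites with negative coordinate sum and,
    after the half-turn, the cup through sites with positive sum. Far in the north-west or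
    south-east quadrant the two are incompatible; the other two quadrants are cut off by the last
    clauses of [below]. *)
Lemma finite_between (u w : Z2) (h k h' k' : nat -> int) (n : nat) :
  (forall a, (n <= a)%N -> h a - a%:Z < - (u.1 + u.2)) ->
  (forall a, (n <= a)%N -> k a - a%:Z < - (u.1 + u.2)) ->
  (forall a, (n <= a)%N -> h' a - a%:Z < - (w.1 + w.2)) ->
  (forall a, (n <= a)%N -> k' a - a%:Z < - (w.1 + w.2)) ->
  finite_set [set z | below u h k z /\ below w h' k' (- z.1, - z.2)].
Proof.
case: u w => u1 u2 [w1 w2] /= Hh Hk Hh' Hk'.
pose m := (n + absz u1 + absz u2 + absz w1 + absz w2).+1.
pose L := (m + m)%N.
pose S := (\sum_(i < L) (absz (h i) + absz (k i) + absz (h' i) + absz (k' i)))%N.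
have HS i : (i < L)%N -> (absz (h i) + absz (k i) + absz (h' i) + absz (k' i) <= S)%N.
  by move=> iL; rewrite /S (bigD1 (Ordinal iL)) //=; lia.
apply: (sub_finite_set _ (finite_box (m + S)%N)) => -[z1 z2] [[/= A B D] [/= A' B' D']].
rewrite mem_box /sup_norm /=.
have up1 : (absz z1 < m)%N -> z2 <= (m + S)%N%:Z.
  have [zu|zu] := leP z1 u1 => zm; last by clear -zu D; rewrite /m; lia.
  have := HS (absz (u1 - z1)); have := A zu; clear -zu zm; rewrite /L /m; lia.
have up2 : (absz z2 < m)%N -> z1 <= (m + S)%N%:Z.
  have [zu|zu] := leP z2 u2 => zm; last by clear -zu D; rewrite /m; lia.
  have := HS (absz (u2 - z2)); have := B zu; clear -zu zm; rewrite /L /m; lia.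
have lo1 : (absz z1 < m)%N -> - z2 <= (m + S)%N%:Z.
  have [zu|zu] := leP (- z1) w1 => zm; last by clear -zu D'; rewrite /m; lia.
  have := HS (absz (w1 - - z1)); have := A' zu; clear -zu zm; rewrite /L /m; lia.
have lo2 : (absz z2 < m)%N -> - z1 <= (m + S)%N%:Z.
  have [zu|zu] := leP (- z2) w2 => zm; last by clear -zu D'; rewrite /m; lia.
  have := HS (absz (w2 - - z2)); have := B' zu; clear -zu zm; rewrite /L /m; lia.
(* It remains to confine [z] to a cross of two strips; within a strip the bounds above limit the
   other coordinate. *)
have N1 : (absz z1 < m)%N \/ (absz z2 < m)%N.
  have [|m1] := ltnP (absz z1) m; first by left.
  have [|m2] := ltnP (absz z2) m; first by right.
  exfalso; have [z1n|z1p] := ltP z1 0; have [z2n|z2p] := ltP z2 0.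
  - by apply: D'; clear -m1 m2 z1n z2n; rewrite /m in m1 m2; lia.
  - have := A ltac:(clear -m1 z1n; rewrite /m in m1; lia).
    have := Hh (absz (u1 - z1)) ltac:(clear -m1 z1n; rewrite /m in m1; lia).
    have := A'; have := B' ltac:(clear -m2 z2p; rewrite /m in m2; lia).
    have := Hk' (absz (w2 - - z2)) ltac:(clear -m2 z2p; rewrite /m in m2; lia).
    clear -m1 m2 z1n z2p; rewrite /m in m1 m2; lia.
  - have := B ltac:(clear -m2 z2n; rewrite /m in m2; lia).
    have := Hk (absz (u2 - z2)) ltac:(clear -m2 z2n; rewrite /m in m2; lia).
    have := A' ltac:(clear -m1 z1p; rewrite /m in m1; lia).
    have := Hh' (absz (w1 - - z1)) ltac:(clear -m1 z1p; rewrite /m in m1; lia).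
    clear -m1 m2 z1p z2n; rewrite /m in m1 m2; lia.
  - by apply: D; clear -m1 m2 z1p z2p; rewrite /m in m1 m2; lia.
have {up1 lo1} : (absz z1 < m)%N -> (absz z2 <= m + S)%N.
  by move=> zm; have := up1 zm; have := lo1 zm; clear; lia.
have {up2 lo2} : (absz z2 < m)%N -> (absz z1 <= m + S)%N.
  by move=> zm; have := up2 zm; have := lo2 zm; clear; lia.
clear -N1; lia.
Qed.

Definition all_regular (m : nat) (e : Z2 -> bool) : Prop :=
  [/\ regular m e, regular m (transpose e), regular m (rotate e) &
      regular m (rotate (transpose e))].

Lemma rotateK : involutive rotate.
Proof. by move=> e; apply/funext => -[x y]; rewrite /rotate /= !opprK negbK. Qed.

Lemma all_regular_rotate m e : all_regular m e -> all_regular m (rotate e).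
Proof.
move=> [A B D E]; split=> //; first by rewrite rotateK.
by rewrite -[transpose (rotate e)]/(rotate (transpose e)) rotateK.
Qed.

(** A north-west walk followed row by row gains in [x + y] and ends far to the left of column [y1].
    A south-east walk followed column by column gains again and returns to that column, where a
    large [x + y] means a large height. *)
Lemma high_point m e C x (y1 B : int) : (0 < m)%N -> all_regular m e ->
  edge_closed e C -> C x -> exists u, [/\ C u, u.1 = y1 & B <= u.2].
Proof.
case: x => x1 x2 m0 [_ _ [N HN] [N' HN']] Ce Cx.
have [h Hh Bh] := HN' (- x2, - x1).
pose K := (N + N' + absz B + 3 * (absz x1 + absz x2 + absz y1)).+1.
pose X := (absz x1 + absz x2)%N.
have mX : (X <= m * X)%N by rewrite leq_pmull.
have mK : (K <= m * K)%N by rewrite leq_pmull.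
have [||T1 T2] := Bh (m * K)%N.
- by apply: leq_trans mK; rewrite /K; clear; lia.
- apply: (@leq_trans K); first by rewrite /sup_norm /K /=; clear; lia.
  by apply: (leq_trans mK); rewrite -[leqLHS]mul1n leq_mul2r; move: m0; clear; lia.
have {}T1 : K%:Z < h (m * K)%N by move: T1; clear -m0; nia.
have {}T2 : K%:Z < (m * K)%N%:Z - h (m * K)%N by move: T2; clear -m0; nia.
have Cx' : [set z | [set z | C (z.2, z.1)] (- z.1, - z.2)] (- x2, - x1).
  by rewrite /= !opprK.
have /= := closed_entry0 (m * K) (rotate_closed (transpose_closed Ce)) Cx' Hh.
rewrite !opprD !opprK; set H := h (m * K)%N in T1 T2 *.
move=> Cv; set v1 := x1 - H in Cv; set v2 := x2 + (m * K)%N%:Z in Cv.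
have [k Hk Bk] := HN (- v1, - v2).
pose a := absz (y1 - v1).
have aE : a%:Z = y1 - v1 by rewrite /a /v1; move: T1; rewrite /K; clear; lia.
(* The second walk starts at sup norm at most [X + m * K], hence at most [m * (X + K)]; this is
   within the range [2 * m * a] of regularity. *)
have a2 : (X + K <= 2 * a)%N by move: aE T1; rewrite /v1 /K /X; clear; lia.
have [||_ S2] := Bk a.
- by move: aE T1; rewrite /v1 /K; clear; lia.
- have := leq_mul (leqnn m) a2; rewrite mulnDr mulnCA mulnA /sup_norm /=.
  move: T1 T2 mX; rewrite /v1 /v2 /X; move: (m * K)%N (m * (_ + _))%N (2 * m * a)%N => M P Q.
  by clear; lia.
have {}S2 : k a < a%:Z by move: S2; clear -m0; nia.
have Cv' : [set z | C (- z.1, - z.2)] (- v1, - v2) by rewrite /= !opprK.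
have /= := closed_entry0 a (rotate_closed Ce) Cv' Hk.
rewrite !opprD !opprK => Cu; exists (v1 + a%:Z, v2 - k a); split=> //=.
  by rewrite aE; clear; lia.
by move: S2 T2; rewrite aE /v1 /v2 /K; clear; lia.
Qed.

(** Take [u] in [C] exactly above [y] and very high: at the row of [y] the south-east walk has
    already moved right of the column of [y]. *)
Lemma cap_exists m e C x y : (0 < m)%N -> all_regular m e -> edge_closed e C -> C x ->
  exists u h k n, [/\ C u, entry_heights (view e u) h,
    entry_heights (view (transpose e) (u.2, u.1)) k, below u h k y &
    forall a, (n <= a)%N ->
      h a - a%:Z < - (u.1 + u.2) /\ k a - a%:Z < - (u.1 + u.2)].
Proof.
case: y => y1 y2 m0 Hr Ce Cx; have [[N HN] [N' HN'] _ _] := Hr.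
have [[u1 u2] [Cu /= E u2B]] := high_point y1 (N' + 2 * absz y2 + absz y1 + 1)%N%:Z m0 Hr Ce Cx.
rewrite {}E in Cu.
have [h Hh Bh] := HN (y1, u2); have [k Hk Bk] := HN' (u2, y1).
(* From [a < m * (a - h a)] and [m * K <= a] follows [K < a - h a], and [K] bounds the coordinate
   sum of [u]. *)
pose K := (absz y1 + absz u2)%N; pose n := (m * K + N + N' + K)%N.
exists (y1, u2), h, k, n; split=> //=.
- split=> /=; [move=> _ | move=> _ | clear; lia].
    by rewrite subrr Hh.1; move: u2B; clear; lia.
  have [||+ _] := Bk (absz (u2 - y2)).
  + by move: u2B; clear; lia.
  + by rewrite /sup_norm /=; move: u2B m0; clear; nia.
  by clear -m0; nia.
- have nK a : (n <= a)%N -> (K <= 2 * m * a)%N /\ (N + N' <= a)%N /\ (m * K <= a)%N.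
    by rewrite /n; split; [move: H m0; clear; nia | move: H; clear; lia].
  move=> a /nK[aK [aN am]]; split.
  + have [||_] := Bh a; first by move: aN; clear; lia.
      by move: aK; rewrite /sup_norm /K /=; clear; lia.
    by move: am; rewrite /K; clear -m0; nia.
  + have [||_] := Bk a; first by move: aN; clear; lia.
      by move: aK; rewrite /sup_norm /K /=; clear; lia.
    by move: am; rewrite /K; clear -m0; nia.
Qed.

Lemma complement_components_finite m e C x y : (0 < m)%N -> all_regular m e ->
  edge_closed e C -> C x -> (~` C) y -> finite_set (lattice_component (~` C) y).
Proof.
move=> m0 Hr Ce Cx nCy.
have [u [h [k [n [Cu Hh Hk By nhk]]]]] := cap_exists y m0 Hr Ce Cx.
have Cx' : [set z | C (- z.1, - z.2)] (- x.1, - x.2) by case: x Cx => ? ? Cx /=; rewrite !opprK.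
have Ce' := rotate_closed Ce.
have [w [h' [k' [n' [Cw Hh' Hk' By' nhk']]]]] :=
  cap_exists (- y.1, - y.2) m0 (all_regular_rotate Hr) Ce' Cx'.
apply: (sub_finite_set _ (@finite_between u w h k h' k' (maxn n n') _ _ _ _)).
- move=> z yz; split; first exact: (below_component Ce Cu Hh Hk By).
  apply: (below_component Ce' Cw Hh' Hk' By').
  case: yz => s [ps <- ns]; exists [seq (- i.1, - i.2) | i <- s]; split.
  + rewrite path_map; apply: sub_path ps => -[i1 i2] [j1 j2] /adjacentP H.
    change (is_true (Defs.adjacent (- i1, - i2) (- j1, - j2))).
    rewrite /Defs.adjacent !inE /e1 /e2 !xpair_eqE /=.
    by case: H => -[-> ->]; clear; lia.
  + by rewrite (last_map (fun i : Z2 => (- i.1, - i.2))).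
  + move=> z'; rewrite -[_ :: _]/(map (fun i : Z2 => (- i.1, - i.2)) (y :: s)) => /mapP[i si ->].
    by rewrite /= !opprK; case: i si => ? ? /ns.
- by move=> a; rewrite geq_max => /andP[/nhk[]].
- by move=> a; rewrite geq_max => /andP[/nhk[]].
- by move=> a; rewrite geq_max => /andP[_ /nhk'[]].
- by move=> a; rewrite geq_max => /andP[_ /nhk'[]].
Qed.

(** * Minimal sites for reachability and the gigantic component *)

Lemma reachable_trans (r : rel Z2) x y z :
  reachable r x y -> reachable r y z -> reachable r x z.
Proof.
move=> [s [ps <-]] [s' [ps' <-]]; exists (s ++ s').
by rewrite cat_path ps ps' last_cat.
Qed.

Lemma reachable_closed e x : edge_closed e [set y | reachable (orthant_edge e) x y].
Proof.
move=> y z xy yz; apply: reachable_trans xy _.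
by exists [:: z]; rewrite /= yz.
Qed.

Lemma reachable_refl (r : rel Z2) x : reachable r x x.
Proof. by exists [::]. Qed.

Definition l1_norm (u : Z2) : nat := (absz u.1 + absz u.2)%N.

(** With [a] the sup norm of [u], one of the four walks brings a coordinate of absolute value [a] to
    0 after [a] columns or rows. The other coordinate changes by [h a], which is strictly between 0
    and [a]. *)
Lemma l1_descent m e : (0 < m)%N -> all_regular m e ->
  exists N, forall u, (N < sup_norm u)%N ->
    exists v, reachable (orthant_edge e) u v /\ (l1_norm v < l1_norm u)%N.
Proof.
move=> m0 [[N1 H1] [N2 H2] [N3 H3] [N4 H4]].
exists (N1 + N2 + N3 + N4)%N => -[u1 u2] uN.
pose C := [set y | reachable (orthant_edge e) (u1, u2) y].
have Ce : edge_closed e C by exact: reachable_closed.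
have Cu : C (u1, u2) by exact: reachable_refl.
set a := sup_norm (u1, u2) in uN.
have ma u : sup_norm u = a -> (sup_norm u <= 2 * m * a)%N by move=> ->; clear -m0; nia.
have reg (h : int) : a%:Z < m%:Z * h /\ a%:Z < m%:Z * (a%:Z - h) -> 0 < h /\ h < a%:Z.
  by clear -m0; nia.
have : [\/ u1 = a%:Z, u1 = - a%:Z, u2 = a%:Z | u2 = - a%:Z].
  rewrite /a /sup_norm /=; clear.
  have [?|[?|[?|?]]] : u1 = (maxn (absz u1) (absz u2))%:Z \/ u1 = - (maxn (absz u1) (absz u2))%:Z \/
    u2 = (maxn (absz u1) (absz u2))%:Z \/ u2 = - (maxn (absz u1) (absz u2))%:Z by lia.
  - by constructor 1.
  - by constructor 2.
  - by constructor 3.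
  - by constructor 4.
case=> uE.
- have [h Hh /(_ a)[||]] := H1 (u1, u2); [by move: uN; clear; lia | exact: ma |].
  move=> h1 h2; have {h1 h2} := reg _ (conj h1 h2).
  have := closed_entry0 a Ce Cu Hh; rewrite /= => Cv hb; exists (u1 - a%:Z, u2 + h a).
  by split=> //; move: hb; rewrite /l1_norm /= uE; clear; lia.
- have [h Hh /(_ a)[||]] := H3 (- u1, - u2).
  + by move: uN; clear; lia.
  + by apply: ma; rewrite /a /sup_norm /= !abszN.
  have Cu' : [set z | C (- z.1, - z.2)] (- u1, - u2) by rewrite /= !opprK.
  move=> h1 h2; have {h1 h2} := reg _ (conj h1 h2).
  have := closed_entry0 a (rotate_closed Ce) Cu' Hh; rewrite /= => Cv hb.
  eexists; split; first exact: Cv.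
  by move: hb; rewrite /l1_norm /= uE; clear; lia.
- have [h Hh /(_ a)[||]] := H2 (u2, u1).
  + by move: uN; clear; lia.
  + by apply: ma; rewrite /a /sup_norm /= maxnC.
  move=> h1 h2; have {h1 h2} := reg _ (conj h1 h2).
  have := closed_entry0 a (transpose_closed Ce) (u := (u2, u1)) Cu Hh; rewrite /= => Cv hb.
  eexists; split; first exact: Cv.
  by move: hb; rewrite /l1_norm /= uE; clear; lia.
- have [h Hh /(_ a)[||]] := H4 (- u2, - u1).
  + by move: uN; clear; lia.
  + by apply: ma; rewrite /a /sup_norm /= !abszN maxnC.
  have Cu' : [set z | [set z | C (z.2, z.1)] (- z.1, - z.2)] (- u2, - u1) by rewrite /= !opprK.
  move=> h1 h2; have {h1 h2} := reg _ (conj h1 h2).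
  have := closed_entry0 a (rotate_closed (transpose_closed Ce)) Cu' Hh; rewrite /= => Cv hb.
  eexists; split; first exact: Cv.
  by move: hb; rewrite /l1_norm /= uE; clear; lia.
Qed.

(** Choose [x] in [s] reaching the fewest members of [s]. A point [u] reached from [x] leads to some
    [v] in [s]; if [v] did not lead back to [x], it would reach strictly fewer members, since [x]
    itself would be missing. *)
Lemma sink_exists (r : rel Z2) (s : seq Z2) : s != [::] ->
  (forall u, exists2 v, v \in s & reachable r u v) ->
  exists x, forall u, reachable r x u -> reachable r u x.
Proof.
move=> s0 Hs; pose c x := count (fun y => `[< reachable r x y >]) s.
have cle x y : reachable r x y -> (c y <= c x)%N.
  move=> xy; apply: sub_count => z /asboolP yz; apply/asboolP; exact: reachable_trans yz.
have [x xs xmin] : exists2 x, x \in s & forall y, y \in s -> (c x <= c y)%N.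
  case: s s0 {Hs} c {cle} => // x0 s _ c.
  have [n] := ubnP (c x0); have : x0 \in x0 :: s by rewrite inE eqxx.
  elim: n {1 3}x0 => // n IH x xs xn.
  have [[y ys yx]|nex] := pselect (exists2 y, y \in x0 :: s & (c y < c x)%N).
    by apply: (IH y ys); apply: leq_trans yx _.
  by exists x => // y ys; rewrite leqNgt; apply/negP => yx; apply: nex; exists y.
exists x => u xu; have [v vs uv] := Hs u.
have xv := reachable_trans xu uv; apply: reachable_trans uv _.
apply: contrapT => nvx; have := xmin v vs; rewrite leqNgt => /negP; apply.
have := count_predUI (fun y => `[< reachable r v y >]) (pred1 x) s.
rewrite [X in (_ + X)%N](eq_count (a2 := pred0)); last first.
  move=> y /=; apply/andP => -[/asboolP vy /eqP yx]; by apply: nvx; rewrite -yx.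
rewrite count_pred0 addn0 => E.
have x1 : (0 < count_mem x s)%N by rewrite -has_count has_pred1.
have : (count (predU (fun y => `[< reachable r v y >]) (pred1 x)) s <= c x)%N.
  apply: sub_count => y /= /orP[/asboolP vy|/eqP ->]; apply/asboolP.
    exact: reachable_trans xv vy.
  exact: reachable_refl.
by rewrite E; apply: leq_trans; rewrite -addn1 leq_add2l.
Qed.

Lemma infinite_unbounded (A : set Z2) :
  (forall B : int, exists2 u, A u & B <= u.2) -> infinite_set A.
Proof.
move=> HA /finite_seqP[s As].
have [u Au] := HA (\sum_(z <- s) absz z.2).+1%:Z.
rewrite As /= in Au; rewrite (big_rem u Au) /=; clear; lia.
Qed.

Lemma regular_gigantic m e (g : Z2 -> local_env) : (0 < m)%N -> all_regular m e ->
  env_edge g = orthant_edge e -> has_gigantic_component g.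
Proof.
move=> m0 Hr Eg; have [N HN] := l1_descent m0 Hr.
have to_box u : exists2 v, v \in box N & reachable (orthant_edge e) u v.
  have [n] := ubnP (l1_norm u); elim: n u => // n IH u un.
  have [uN|/HN[v [uv vu]]] := leqP (sup_norm u) N.
    by exists u; [rewrite mem_box | exact: reachable_refl].
  have [w wN vw] := IH v (leq_trans vu un).
  by exists w => //; exact: reachable_trans uv vw.
have [|x Hx] := sink_exists (s := box N) _ to_box.
  by rewrite -size_eq0 size_box.
exists x; have ME : mutual_component g x = [set y | reachable (orthant_edge e) x y].
  by apply/seteqP; split => y; rewrite /mutual_component Eg /=; [case | move=> xy; split; auto].
have Cc := @reachable_closed e x; have Cx : [set y | reachable (orthant_edge e) x y] x.
  exact: reachable_refl.
rewrite ME; split=> [|y ny].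
  apply: infinite_unbounded => B; have [u [Cu _ uB]] := high_point 0 B m0 Hr Cc Cx.
  by exists u.
exact: complement_components_finite m0 Hr Cc Cx ny.
Qed.

(** * Almost sure statements *)

Lemma iid_bernoulli_field d d' (T : measurableType d) (T' : measurableType d')
    (R : realType) (P : probability T R) (X : Z2 -> {RV P >-> T'})
    (nu : probability T' R) (b : T' -> bool) (q : R) :
  iid X nu -> measurable [set y | b y] -> nu [set y | b y] = q%:E ->
  bernoulli_field P (fun i t => b (X i t)) q.
Proof.
move=> [indep law] mb nub.
have mB v : measurable [set y | b y = v].
  exact: measurable_value.
have nuB v : nu [set y | b y = v] = (if v then q else 1 - q)%:E.
  case: v => //; rewrite (_ : [set y | _] = ~` [set y | b y]).
    by rewrite probability_setC // nub.
  by apply/seteqP; split => y /=; case: (b y).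
split=> [i|l ul].
  by have := measurable_funP (X i) measurableT _ mb; rewrite setTI.
have lv i v : (i, v) \in l -> ((i, true) \in l) = v.
  move=> il; move: il ul; clear; elim: l => // -[j w] l IH; rewrite !inE /= !xpair_eqE.
  case/orP => [/andP[/eqP <- /eqP <-]|il] /andP[jl ul].
    rewrite eqxx /=; case: v {IH} => //=; apply/negP => il.
    by move/negP: jl; apply; apply/mapP; exists (i, true).
  rewrite (IH il ul); have /negbTE -> : i != j; last by [].
  by apply: contraNneq jl => <-; apply/mapP; exists (i, v).
(* Independence asks for a family of sets over all sites. As the sites of [l] are distinct,
   membership of [(i, true)] recovers the value prescribed at [i]. *)
pose B i := [set y | b y = ((i, true) \in l)].
have := indep _ B ul (fun i => mB _).
rewrite [X in (P X = _)%E](_ : _ = cylinder (fun i t => b (X i t)) l).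
  move=> ->; rewrite big_map -prodEFin big_seq [RHS]big_seq; apply: eq_bigr => -[i v] il /=.
  rewrite -[P _]/(distribution P (X i) (B i)) law; last exact: mB.
  by rewrite /B nuB (lv _ _ il).
apply/seteqP; split => t /= Ht.
  apply/allP => -[i v] il /=; have := Ht i; rewrite /B /= (lv _ _ il) => -> //.
  by apply/mapP; exists (i, v).
move=> i /mapP[[j v] jl ->]; rewrite /B /= (lv _ _ jl).
by move/allP: Ht => /(_ _ jl)/eqP.
Qed.

Lemma steps_in_NE_SW : steps_in [:: e1; e2] != steps_in [:: - e1; - e2].
Proof.
apply/negP => /eqP/finset.setP /(_ (SeqSub (isT : e1 \in steps))).
by rewrite !finset.inE.
Qed.

Lemma env_edge_orthant (g : Z2 -> local_env) :
  (forall x, g x = steps_in [:: e1; e2] \/ g x = steps_in [:: - e1; - e2]) ->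
  env_edge g = orthant_edge (fun x => g x == steps_in [:: e1; e2]).
Proof.
move=> Hg; apply/funext => -[x1 x2]; apply/funext => -[y1 y2].
have E (s : seq Z2) : {subset s <= steps} ->
    [exists a : step, (a \in (steps_in s : {set step})) && ((y1, y2) - (x1, x2) == val a)] =
    ((y1, y2) - (x1, x2) \in s).
  move=> ss; apply/existsP/idP => [[a /andP[]]|ys].
    by rewrite finset.inE => sa /eqP ->.
  exists (SeqSub (ss _ ys)); rewrite finset.inE /=; by rewrite ys eqxx.
rewrite /env_edge /orthant_edge; have [gx|gx] := Hg (x1, x2); rewrite gx.
  rewrite eqxx E; last by move=> z; rewrite !inE => /orP[] ->; rewrite ?orbT.
  by rewrite !inE /e1 /e2 !xpair_eqE /=; lia.
rewrite E; last by move=> z; rewrite !inE => /orP[] ->; rewrite ?orbT.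
rewrite eq_sym (negbTE steps_in_NE_SW).
by rewrite !inE /e1 /e2 !xpair_eqE /=; lia.
Qed.

Lemma measurable_path d (T : measurableType d) (op : Z2 -> T -> bool) x s :
  (forall i, measurable [set t | op i t]) ->
  measurable [set t | path (triangular_edge (op ^~ t)) x s].
Proof.
move=> mop; elim: s x => [|y s IH] x /=.
  by rewrite (_ : [set t | _] = setT); [exact: measurableT | apply/seteqP; split].
case E: (y \in [:: x - e1; x + e2; x - e1 + e2]).
  rewrite (_ : [set t | _] = [set t | op x t] `&` [set t | path (triangular_edge (op ^~ t)) y s]).
    exact: measurableI.
  by apply/seteqP; split => t /=; rewrite /triangular_edge E andbT => /andP.
rewrite (_ : [set t | _] = set0); first exact: measurable0.
by apply/seteqP; split => t //=; rewrite /triangular_edge E andbF.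
Qed.

Lemma countable_bigcup_measurable d (T : measurableType d) (I : countType) (A : I -> set T) :
  (forall i, measurable (A i)) -> measurable [set t | exists i, A i t].
Proof.
move=> mA; rewrite (_ : [set t | _] = \bigcup_n (if unpickle n is Some i then A i else set0)).
  apply: bigcupT_measurable => n; case: (unpickle n) => // i; exact: mA.
apply/seteqP; split => t /=.
  by move=> [i Ai]; exists (pickle i) => //; rewrite pickleK.
by move=> [n _]; case: (unpickle n) => // i Ai; exists i.
Qed.

Lemma infinite_setE (A : set Z2) :
  infinite_set A <-> forall n, exists z, A z /\ z \notin box n.
Proof.
split=> [iA n|HA /finite_seqP[s As]].
  apply: contrapT => nex; apply: iA; apply: (sub_finite_set _ (finite_box n)) => z Az /=.
  by apply/negPn/negP => zn; apply: nex; exists z.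
have [z] := HA (\sum_(z <- s) sup_norm z)%N.
rewrite As /= mem_box => -[zs]; rewrite (big_rem z zs) /=; clear; lia.
Qed.

Lemma measurable_infinite_cluster d (T : measurableType d) (op : Z2 -> T -> bool) :
  (forall i, measurable [set t | op i t]) ->
  measurable [set t | infinite_set (triangular_cluster (op ^~ t))].
Proof.
move=> mop.
rewrite (_ : [set t | _] = \bigcap_n [set t | exists s : seq Z2,
    path (triangular_edge (op ^~ t)) 0 s && (last 0 s \notin box n)]).
  apply: bigcapT_measurable => n; apply: countable_bigcup_measurable => s.
  case E: (last 0 s \notin box n).
    rewrite [X in measurable X](_ : _ = [set t | path (triangular_edge (op ^~ t)) 0 s]).
      exact: measurable_path.
    by apply/seteqP; split => t /=; rewrite andbT.
  rewrite [X in measurable X](_ : _ = set0); first exact: measurable0.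
  by apply/seteqP; split => t //=; rewrite andbF.
apply/seteqP; split => t /=; rewrite infinite_setE => H n.
  by move=> _; have [z [[s [ps <-]] zn]] := H n; exists s; rewrite ps.
have [s /andP[ps sn]] := H n I; exists (last 0 s); split=> //.
by exists s.
Qed.

Lemma ae_forall_countable d (T : measurableType d) (R : realType)
    (P : probability T R) (I : countType) (A : I -> T -> Prop) :
  (forall i, {ae P, forall t, A i t}) -> {ae P, forall t, forall i, A i t}.
Proof.
move=> HA; have : {ae P, forall t, forall n, if unpickle n is Some i then A i t else True}.
  apply: ae_foralln => n; case: (unpickle n) => [i|]; first exact: HA.
  exact: aeW.
by apply: filterS => t H i; have := H (pickle i); rewrite pickleK.
Qed.

Lemma antitranspose_inj : injective (fun z : Z2 => (- z.2, - z.1)).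
Proof. by move=> [x y] [x' y'] /= [/oppr_inj -> /oppr_inj ->]. Qed.

Lemma triangular_cluster_finite_ae d (T : measurableType d) (R : realType)
    (P : probability T R) (F : Z2 -> T -> bool) (q : R) :
  bernoulli_field P F q -> 1 - q <= 11 / 20 ->
  0 <= (1 - q) ^+ 3 + 2 * (1 - q) - 1 ->
  {ae P, forall t, finite_set (triangular_cluster (F ^~ t))}.
Proof.
move=> FF r1 r0; have [m Hm] := threshold_rate_base R.
have A := regular_ae Hm FF r1 r0.
have B := regular_ae Hm (bernoulli_field_inj antitranspose_inj FF) r1 r0.
apply: filterS2 A B => t; exact: regular_triangular_finite.
Qed.

Lemma all_regular_ae d (T : measurableType d) (R : realType)
    (P : probability T R) (F : Z2 -> T -> bool) (p : R) (m : nat) :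
  threshold R ^+ m * rate_base R <= 1 -> bernoulli_field P F p ->
  0 <= p ^+ 3 + 2 * p - 1 -> 0 <= (1 - p) ^+ 3 + 2 * (1 - p) - 1 ->
  {ae P, forall t, all_regular m (F ^~ t)}.
Proof.
move=> Hm FF p0 r0; have pl := closed_density_ge p0; have rl := closed_density_ge r0.
have ti : injective (fun z : Z2 => (z.2, z.1)) by move=> [x y] [x' y'] /= [-> ->].
have oi : injective (fun z : Z2 => (- z.1, - z.2)).
  by move=> [x y] [x' y'] /= [/oppr_inj -> /oppr_inj ->].
have A1 := regular_ae Hm FF ltac:(lra) r0.
have A2 := regular_ae Hm (bernoulli_field_inj ti FF) ltac:(lra) r0.
have A3 := regular_ae Hm (bernoulli_field_neg (bernoulli_field_inj oi FF)).
have A4 := regular_ae Hm (bernoulli_field_neg (bernoulli_field_inj antitranspose_inj FF)).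
(* The negated fields have parameter [1 - p], so the SW density seen by these two walks is [p]. *)
rewrite subKr in A3 A4.
have {}A3 := A3 ltac:(lra) p0; have {}A4 := A4 ltac:(lra) p0.
by apply: filterS2 (filterI A1 A2) (filterI A3 A4) => t [? ?] [? ?]; split.
Qed.

Lemma two_valued_ae d (T : measurableType d) (R : realType) (P : probability T R)
    (mu : probability local_env R) (G : Z2 -> {RV P >-> local_env}) (p : R)
    (a b : local_env) :
  iid G mu -> a != b -> mu [set a] = p%:E -> mu [set b] = (1 - p)%:E ->
  {ae P, forall t, forall i, G i t = a \/ G i t = b}.
Proof.
move=> [_ law] ab mua mub; apply: ae_forall_countable => i.
have mS (A : set local_env) : measurable A by [].
have mab : mu (~` ([set a] `|` [set b])) = 0%E.
  rewrite probability_setC // measureU //; last first.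
    by apply/seteqP; split => // x /= [-> E]; move: ab; rewrite E eqxx.
  transitivity (1 - (p%:E + (1 - p)%:E))%E; first by congr (1 - (_ + _))%E.
  by rewrite -EFinD [p + _]addrC subrK subrr.
exists (G i @^-1` (~` ([set a] `|` [set b]))); split.
- by have := measurable_funP (G i) measurableT _ (mS (~` ([set a] `|` [set b]))); rewrite setTI.
- by rewrite -[LHS]/(distribution P (G i) _) law.
- by move=> t /= nt [Ga|Gb]; apply: nt; [left|right].
Qed.

Theorem theorem4p12 (R : realType) :
  (forall (d : measure_display) (T : measurableType d) (P : probability T R)
      (mu : probability local_env R) (G : Z2 -> {RV P >-> local_env}) (p : R),
    iid G mu ->
    mu [set steps_in [:: e1; e2]] = p%:E ->
    mu [set steps_in [:: - e1; - e2]] = (1 - p)%:E ->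
    0 <= p ^+ 3 + 2 * p - 1 ->
    0 <= (1 - p) ^+ 3 + 2 * (1 - p) - 1 ->
    {ae P, forall t, has_gigantic_component (G ^~ t)}) /\
  (forall (d : R -> measure_display) (T : forall q, measurableType (d q))
      (P : forall q, probability (T q) R)
      (op : forall q, Z2 -> {RV (P q) >-> bool}) (pcT : R),
    triangular_percolation op ->
    critical_value op pcT ->
    5466 / 10 ^+ 4 <= pcT).
Proof.
split=> [d T P mu G p HG muNE muSW p0 r0|d T P op pcT Hop [_ _ Hpc]].
  have [m Hm] := threshold_rate_base R; have m0 := threshold_rate_base_gt0 Hm.
  have FF : bernoulli_field P (fun i t => G i t == steps_in [:: e1; e2]) p.
    apply: (iid_bernoulli_field (b := fun g => g == steps_in [:: e1; e2]) HG) => //.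
    by rewrite -muNE; congr (mu _); apply/seteqP; split => g /= /eqP.
  apply: filterS2 (all_regular_ae Hm FF p0 r0) (two_valued_ae HG steps_in_NE_SW muNE muSW).
  by move=> t Ht Gt; apply: regular_gigantic m0 Ht (env_edge_orthant Gt).
rewrite leNgt; apply/negP => pc.
(* A supercritical [q] below 0.5466; taking it above 1/2 ensures [1 - q <= 11 / 20]. *)
pose q := (Num.max pcT (1 / 2) + 5466 / 10 ^+ 4) / 2.
have [qpc [q1 q2]] : pcT < q /\ 1 / 2 < q /\ q < 5466 / 10 ^+ 4.
  by rewrite /q; have [|] := leP pcT (1 / 2); lra.
have q01 : 0 <= q <= 1 by lra.
(* Here [1 - q > 0.4534], just above the root of [r ^ 3 + 2 r = 1]; this is where the numerical
   bound comes from. *)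
have r0 : 0 <= (1 - q) ^+ 3 + 2 * (1 - q) - 1.
  move: (1 - q) (subKr 1 q) q1 q2 => r <- r1 r2; nra.
have FF : bernoulli_field (P q) (op q) q.
  apply: (iid_bernoulli_field (b := id) (Hop q q01)) => //.
  have /= -> := bernoulli_probE q01 [set y : bool | y].
  by rewrite !diracE !mem_setE /= mule1 mule0 adde0.
have [N [mN PN sN]] := triangular_cluster_finite_ae FF ltac:(lra) r0.
have := Hpc q q01 qpc; rewrite (_ : P q _ = 0%E) ?ltxx //.
apply: (subset_measure0 _ mN) => //.
  by apply: measurable_infinite_cluster; case: FF.
Qed.
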